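(* Let $T$ be a bicentred tree, let $e=uv$ be its central edge, and let $T_1$ and $T_2$ be the components of $T-e$, with $T_1$ rooted at its endpoint of $e$ and $T_2$ rooted at its endpoint of $e$. Then for every integer $k\ge 2$ the following are equivalent: (i) $D(T)=k$ and $D'(T)=k+1$; (ii) $D(T)=k$ and there is no distinguishing $k$-vertex colouring $c$ of $T$ with $c(u)=c(v)$; (iii) $T\in\mathcal T_k$, i.e. the rooted trees $T_1$ and $T_2$ are isomorphic and $T_1$ has a unique distinguishing $k$-edge colouring up to isomorphism.
   Context: Trees may be infinite. A vertex (edge) colouring of a graph is distinguishing if no non-identity automorphism preserves it, where $\gamma$ preserves a colouring if every vertex (edge) has the same colour as its image under $\gamma$. The distinguishing number $D(G)$ is the least number of colours of a distinguishing vertex colouring, and the distinguishing index $D'(G)$ the least number of colours of a distinguishing edge colouring. For a rooted tree, automorphisms are those fixing the root, and two colourings are isomorphic if one is mapped to the other by such an automorphism. A centre of a finite tree is a vertex minimising the maximal distance to the other vertices; a finite tree is bicentred if it has two (necessarily adjacent) centres, the edge joining them being the central edge. A rayless tree (one with no one-sided infinite path) has a canonical finite subtree, its kernel (Schmidt), preserved by all automorphisms; it is bicentred if its kernel is, with the same central edge. The family $\mathcal T_k$ consists of the bicentred trees with central edge $e$ such that the rooted trees attached to the two endpoints of $e$ are isomorphic and each has, up to isomorphism, a unique distinguishing $k$-edge colouring.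
   Formalization: The tree T is assumed to have a vertex other than u and v, i.e. T is not K_2; for K_2 the index D'(T) is undefined, and (iii) holds for every k while D(T)=2, so the equivalence fails. *)

(* Defs.v *)
(* MathComp world, with the classical sets of MathComp-Analysis. *)
From mathcomp Require Import all_boot.
From mathcomp Require Import boolp classical_sets functions cardinality.

Set Implicit Arguments.
Unset Strict Implicit.
Unset Printing Implicit Defensive.

Local Open Scope classical_set_scope.

(* Simple graphs, possibly infinite.  Classically every type is an eqType and
   every relation is boolean, so nothing is lost by asking for both. *)
Record graph := Graph {
  vertex :> eqType;
  adj : rel vertex;
  adj_sym : symmetric adj;
  adj_irr : irreflexive adj }.

Record rooted_graph := Rooted { rgraph :> graph; root : rgraph }.

Section Subgraphs.
Variable G : graph.

Definition connected_to (x y : G) : Prop :=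
  exists2 p : seq G, path (@adj G) x p & last x p = y.

Definition connected : Prop := forall x y : G, connected_to x y.

Definition acyclic : Prop :=
  forall s : seq G, 2 < size s -> ~ ucycle (@adj G) s.

Definition is_tree : Prop := connected /\ acyclic.

Definition rayless : Prop :=
  ~ exists r : nat -> G, injective r /\ forall n, adj (r n) (r n.+1).

Section Induced.
Variable A : set G.
Let iadj : rel A := fun x y => adj (val x) (val y).
Fact iadj_sym : symmetric iadj. Proof. by move=> x y; apply: adj_sym. Qed.
Fact iadj_irr : irreflexive iadj. Proof. by move=> x; apply: adj_irr. Qed.
Definition induced : graph := Graph iadj_sym iadj_irr.
End Induced.

Section DeleteEdge.
Variables u v : G.
Let dadj : rel G := fun x y =>
  adj x y && ~~ ((x == u) && (y == v) || (x == v) && (y == u)).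
Fact dadj_sym : symmetric dadj.
Proof.
by move=> x y; rewrite /dadj adj_sym orbC [(y == u) && _]andbC [(y == v) && _]andbC.
Qed.
Fact dadj_irr : irreflexive dadj.
Proof. by move=> x; rewrite /dadj adj_irr. Qed.
Definition delete_edge : graph := Graph dadj_sym dadj_irr.
End DeleteEdge.

Definition component_set (x : G) : set G := [set y | connected_to x y].

Fact component_refl (x : G) : x \in component_set x.
Proof. by apply/mem_set; exists [::]. Qed.

Definition component (x : G) : rooted_graph :=
  @Rooted (induced (component_set x)) (exist _ x (component_refl x)).

Definition is_dist (x y : G) (n : nat) : Prop :=
  (exists p, [/\ path (@adj G) x p, last x p = y & size p = n]) /\
  (forall p, path (@adj G) x p -> last x p = y -> n <= size p).

Definition is_eccentricity (x : G) (r : nat) : Prop :=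
  (exists y, is_dist x y r) /\ (forall y n, is_dist x y n -> n <= r).

Definition is_centre (x : G) : Prop :=
  exists2 r, is_eccentricity x r & forall y s, is_eccentricity y s -> r <= s.

End Subgraphs.

(* Ordinals presented as well-founded trees: [Ord f] stands for the least
   ordinal above all [f j]. *)
Inductive ord : Type := Ord (J : Type) (f : J -> ord).

(* Schmidt's rank is at most [a]: some finite set of vertices leaves only
   components of rank smaller than [a].  The graphs of rank 0 are the finite
   ones. *)
Fixpoint rank_le (a : ord) (G : graph) : Prop :=
  let: Ord J f := a in
  exists2 F : set G, finite_set F &
    forall x : induced (~` F), exists j : J, rank_le (f j) (component x).

Definition rank_lt (H G : graph) : Prop :=
  exists2 a, rank_le a H & ~ rank_le a G.

(* This also makes the universe of the index types of [ord] large enough for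
   the ranks of all graphs. *)
Lemma ranked_of_components (G : graph) (F : set G) : finite_set F ->
  (forall x : induced (~` F), exists a, rank_le a (component x)) ->
  exists a, rank_le a G.
Proof.
move=> finF /choice[f fP]; exists (Ord f), F => // x.
by exists x; apply: fP.
Qed.

Definition separates (G : graph) (K : set G) : Prop :=
  [/\ finite_set K, connected (induced K) &
      forall x : induced (~` K), rank_lt (component x) G].

(* The kernel is the least finite subtree whose removal leaves only components
   of smaller rank, i.e. the subtree spanned by the least finite set of
   vertices with this property. *)
Definition is_kernel (G : graph) (K : set G) : Prop :=
  separates K /\ forall L : set G, separates L -> K `<=` L.

(* No graph has smaller rank than a finite one, so that the kernel of a finite
   tree is the whole tree and the definitions below cover finite trees. *)
Lemma is_kernel_finite (G : graph) : finite_set [set: G] -> connected G ->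
  is_kernel [set: G].
Proof.
move=> finG conG; have rank0 a : rank_le a G.
  case: a => J f; exists setT => // -[x xP]; exfalso.
  by move: xP => /set_mem; rewrite setCT.
split=> [|L [_ _ LP] x _]; last first.
  apply: contrapT => nLx.
  by have [a _] := LP (exist _ x (mem_set nLx)); apply.
split=> // [[x xT] [y yT]|[x xP]]; last first.
  by exfalso; move: xP => /set_mem; rewrite setCT.
have [p xp py] := conG x y.
pose i (z : G) : induced [set: G] := exist _ z (mem_set (I : [set: G] z)).
have ival w : i (val w) = w by apply: val_inj.
have -> : exist _ x xT = i x by apply: val_inj.
have -> : exist _ y yT = i y by apply: val_inj.
exists (map i p); first by rewrite path_map.
by rewrite last_map py.
Qed.

(* [T] is a bicentred tree and [uv] is its central edge. *)
Definition bicentred_at (T : graph) (u v : T) : Prop :=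
  [/\ is_tree T, rayless T, adj u v &
      exists (K : set T) (u' v' : induced K),
        [/\ is_kernel K, val u' = u, val v' = v &
            forall w : induced K, is_centre w <-> w = u' \/ w = v']].

Definition automorphism (G : graph) (g : G -> G) : Prop :=
  bijective g /\ forall x y, adj (g x) (g y) = adj x y.

Definition rooted_isomorphism (G H : rooted_graph) (g : G -> H) : Prop :=
  [/\ bijective g, forall x y, adj (g x) (g y) = adj x y &
      g (root G) = root H].

Definition rooted_isomorphic (G H : rooted_graph) : Prop :=
  exists g : G -> H, rooted_isomorphism g.

(* The colours are the natural numbers below [k], not all of which have to be
   used. *)
Definition vertex_colouring (G : graph) (k : nat) (c : G -> nat) : Prop :=
  forall x, c x < k.

(* An edge colouring is given by its values [c x y = c y x] on adjacent pairs;
   the values on other pairs are junk. *)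
Definition edge_colouring (G : graph) (k : nat) (c : G -> G -> nat) : Prop :=
  forall x y, adj x y -> c x y = c y x /\ c x y < k.

(* [g] maps the colouring [c] to [d]. *)
Definition maps_edge_colouring (G : graph) (g : G -> G) (c d : G -> G -> nat) :
  Prop := forall x y, adj x y -> d (g x) (g y) = c x y.

Definition vertex_distinguishing (G : graph) (c : G -> nat) : Prop :=
  forall g, automorphism g -> (forall x, c (g x) = c x) -> g =1 id.

Definition edge_distinguishing (G : graph) (c : G -> G -> nat) : Prop :=
  forall g, automorphism g -> maps_edge_colouring g c c -> g =1 id.

Definition rooted_edge_distinguishing (G : rooted_graph) (c : G -> G -> nat) :
  Prop :=
  forall g : G -> G, rooted_isomorphism g -> maps_edge_colouring g c c ->
    g =1 id.

(* [is_least P k]: [k] is the least number with property [P]. *)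
Definition is_least (P : nat -> Prop) (k : nat) : Prop :=
  P k /\ forall j, P j -> k <= j.

(* D(G) = k *)
Definition distinguishing_number_is (G : graph) (k : nat) : Prop :=
  is_least (fun j => exists c : G -> nat,
    vertex_colouring j c /\ vertex_distinguishing c) k.

(* D'(G) = k *)
Definition distinguishing_index_is (G : graph) (k : nat) : Prop :=
  is_least (fun j => exists c : G -> G -> nat,
    edge_colouring j c /\ edge_distinguishing c) k.

Definition unique_rooted_edge_distinguishing (G : rooted_graph) (k : nat) :
  Prop :=
  (exists c : G -> G -> nat,
     edge_colouring k c /\ rooted_edge_distinguishing c) /\
  (forall c d : G -> G -> nat,
     edge_colouring k c -> rooted_edge_distinguishing c ->
     edge_colouring k d -> rooted_edge_distinguishing d ->
     exists g : G -> G, rooted_isomorphism g /\ maps_edge_colouring g c d).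

(* Main.v *)
(* An automorphism of T preserves the kernel, hence fixes or exchanges u and v.
   Reading the colour of a vertex as that of the edge to its parent, a
   k-colouring of the vertices or edges of T amounts to k-edge colourings c of
   T1 and d of T2 together with colours for u and v or for e.  It is
   distinguishing iff c and d are and no isomorphism T1 -> T2 maps c to d, the
   last condition being void for vertex colourings with different colours on
   u and v.  Each of (i), (ii), (iii) then says that T1 and T2 have
   distinguishing k-edge colourings, all of which are isomorphic.  Fewer colours
   never suffice in that case, since giving a fresh colour to a single edge of
   T1 destroys the isomorphism. *)
From mathcomp Require Import all_boot.
From mathcomp Require Import boolp classical_sets functions cardinality.
Require Import Defs.

Set Implicit Arguments.
Unset Strict Implicit.
Unset Printing Implicit Defensive.

Local Open Scope classical_set_scope.

(** * Invariance of rank, kernel and centres under isomorphism *)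

Lemma inj_surj_bijective (A B : Type) (f : A -> B) :
  injective f -> (forall y, exists x, f x = y) -> bijective f.
Proof.
by move=> finj /choice[g fg]; exists g => // x; apply: finj; rewrite fg.
Qed.

Definition graph_isomorphism (G H : graph) (f : G -> H) : Prop :=
  bijective f /\ forall x y, adj (f x) (f y) = adj x y.

Lemma graph_isomorphism_inv (G H : graph) (f : G -> H) :
  graph_isomorphism f ->
  exists g, [/\ graph_isomorphism g, cancel f g & cancel g f].
Proof.
move=> [[g fg gf] fadj]; exists g; split=> //; split; first by exists f.
by move=> x y; rewrite -fadj !gf.
Qed.

Lemma graph_isomorphism_induced (G H : graph) (f : G -> H) (A : set G)
    (B : set H) : graph_isomorphism f -> (forall x, A x <-> B (f x)) ->
  exists g : induced A -> induced B,
    graph_isomorphism g /\ forall x, val (g x) = f (val x).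
Proof.
move=> [fbij fadj] AB.
have fB (x : induced A) : f (val x) \in B.
  by apply/mem_set/AB/set_mem; case: x.
exists (fun x => exist _ (f (val x)) (fB x)); split=> //.
split; last by move=> x y; apply: fadj.
apply: inj_surj_bijective => [x y /(congr1 val) /= /(bij_inj fbij)/val_inj//|].
move=> [y yB]; have [g fg gf] := fbij.
have gyA : g y \in A by apply/mem_set/AB; rewrite gf; apply: set_mem.
by exists (exist _ (g y) gyA); apply: val_inj; rewrite /= gf.
Qed.

Lemma connected_to_morph (G H : graph) (f : G -> H) (x y : G) :
  {mono f : a b / adj a b} -> connected_to x y -> connected_to (f x) (f y).
Proof.
move=> fadj [p xp <-]; exists (map f p); last by rewrite last_map.
by rewrite (mono_path fadj).
Qed.

Lemma connected_to_isomorphism (G H : graph) (f : G -> H) (x y : G) :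
  graph_isomorphism f -> connected_to x y <-> connected_to (f x) (f y).
Proof.
move=> fiso; split; first by apply: connected_to_morph; case: fiso.
have [g [[_ gadj] fg gf]] := graph_isomorphism_inv fiso.
by move=> /(connected_to_morph gadj); rewrite !fg.
Qed.

Lemma component_isomorphism (G H : graph) (f : G -> H) (x : G) :
  graph_isomorphism f ->
  exists g : component x -> component (f x), graph_isomorphism g.
Proof.
move=> fiso.
have [|g [giso _]] := @graph_isomorphism_induced _ _ f (component_set x)
  (component_set (f x)) fiso; last by exists g.
by move=> y; apply: connected_to_isomorphism.
Qed.

Lemma image_preimage_iff (A B : Type) (f : A -> B) (F : set A) (x : A) :
  injective f -> F x <-> (f @` F) (f x).
Proof. by move=> finj; split=> [Fx|[y Fy /finj <-]//]; exists x. Qed.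

(** This matching of the leftover components transports both rank bounds and separating sets. *)
Lemma component_image_isomorphism (G H : graph) (f : G -> H) (F : set G) :
  graph_isomorphism f -> forall y : induced (~` (f @` F)),
  exists x (g : @component (induced (~` F)) x -> component y),
    graph_isomorphism g.
Proof.
move=> fiso; have finj : injective f by apply: bij_inj; case: fiso.
have [|h [hiso _]] :=
  @graph_isomorphism_induced _ _ f (~` F) (~` (f @` F)) fiso.
  by move=> x; split=> nFx Fx; apply: nFx; apply/(image_preimage_iff F x finj).
move=> y; have [[h' hh' h'h] _] := hiso.
exists (h' y); have := component_isomorphism (h' y) hiso.
by rewrite h'h.
Qed.

(** Induction on the ordinal: the image of [F] is finite and leaves components isomorphic to
    components left by [F]. *)
Lemma rank_le_isomorphism (a : ord) (G H : graph) (f : G -> H) :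
  graph_isomorphism f -> rank_le a G -> rank_le a H.
Proof.
elim: a G H f => J r IH G H f fiso /= [F finF FP].
exists (f @` F); first exact: finite_image.
move=> y; have [x [g giso]] := component_image_isomorphism fiso y.
by have [j rj] := FP x; exists j; apply: IH giso rj.
Qed.

Lemma automorphism_separates (G : graph) (g : G -> G) (K : set G) :
  automorphism g -> separates K -> separates (g @` K).
Proof.
move=> gaut [finK conK rkK]; split; first exact: finite_image.
  have [x|h [hiso _]] :=
    @graph_isomorphism_induced _ _ g K (g @` K) gaut.
    by apply: image_preimage_iff; apply: bij_inj; case: gaut.
  have [[h' hh' h'h] _] := hiso.
  move=> x y; rewrite -(h'h x) -(h'h y).
  by apply/(connected_to_isomorphism (h' x) (h' y) hiso)/conK.
move=> y; have [x [h hiso]] := component_image_isomorphism gaut y.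
have [a ax aG] := rkK x; exists a => //; exact: rank_le_isomorphism hiso ax.
Qed.

(** Leastness puts [K] inside its images under [g] and under the inverse of [g], since both images
    separate. *)
Lemma automorphism_kernel (G : graph) (g : G -> G) (K : set G) (x : G) :
  automorphism g -> is_kernel K -> K x <-> K (g x).
Proof.
move=> gaut [sepK minK].
have [h [haut gh hg]] := graph_isomorphism_inv gaut.
split=> [Kx|Kgx].
  have [y Ky <-] := minK _ (automorphism_separates haut sepK) x Kx.
  by rewrite hg.
have [y Ky gy] := minK _ (automorphism_separates gaut sepK) _ Kgx.
by rewrite -(gh x) -gy gh.
Qed.

Lemma dist_isomorphism (G H : graph) (f : G -> H) (x y : G) (n : nat) :
  graph_isomorphism f -> is_dist (f x) (f y) n <-> is_dist x y n.
Proof.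
(* One direction is stated for arbitrary graphs so that it applies to the inverse isomorphism
   too. *)
have walk (G' H' : graph) (f' : G' -> H') a b m : graph_isomorphism f' ->
    (exists p, [/\ path (@adj _) a p, last a p = b & size p = m]) ->
    exists p, [/\ path (@adj _) (f' a) p, last (f' a) p = f' b & size p = m].
  move=> [_ fadj] [p [ap pb pm]]; exists (map f' p); split.
  - by rewrite (mono_path fadj).
  - by rewrite last_map pb.
  - by rewrite size_map.
have dist (G' H' : graph) (f' : G' -> H') a b m : graph_isomorphism f' ->
    is_dist a b m -> is_dist (f' a) (f' b) m.
  move=> fiso [ex_p min_p]; split; first exact: walk.
  move=> q aq qb; have [h [hiso fh hf]] := graph_isomorphism_inv fiso.
  have [|r [ar rb <-]] := walk _ _ h (f' a) (f' b) (size q) hiso.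
    by exists q.
  by apply: min_p; move: ar rb; rewrite !fh.
move=> fiso; split; last exact: dist.
have [h [hiso fh hf]] := graph_isomorphism_inv fiso.
by move=> /(dist _ _ _ _ _ _ hiso); rewrite !fh.
Qed.

Lemma eccentricity_isomorphism (G H : graph) (f : G -> H) (x : G) (r : nat) :
  graph_isomorphism f -> is_eccentricity (f x) r <-> is_eccentricity x r.
Proof.
move=> fiso; have [[h fh hf] _] := fiso.
split=> -[[y xyr] ecc]; split.
- by exists (h y); rewrite -(dist_isomorphism _ _ _ fiso) hf.
- by move=> z n xzn; apply: (ecc (f z)); rewrite dist_isomorphism.
- by exists (f y); rewrite dist_isomorphism.
- by move=> z n; rewrite -(hf z) dist_isomorphism //; apply: ecc.
Qed.

Lemma centre_isomorphism (G H : graph) (f : G -> H) (x : G) :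
  graph_isomorphism f -> is_centre x -> is_centre (f x).
Proof.
move=> fiso [r xr min_r]; exists r; first by rewrite eccentricity_isomorphism.
have [[h fh hf] _] := fiso.
by move=> y s; rewrite -(hf y) eccentricity_isomorphism //; apply: min_r.
Qed.

(** [g] restricts to the kernel and so permutes its two centres, which are distinct because they are
    adjacent. *)
Lemma bicentred_fix_or_swap (T : graph) (u v : T) (g : T -> T) :
  bicentred_at u v -> automorphism g ->
  g u = u /\ g v = v \/ g u = v /\ g v = u.
Proof.
move=> [_ _ adjuv [K [u' [v' [kerK u'E v'E centre]]]]] gaut.
have [x|h [hiso hE]] := @graph_isomorphism_induced _ _ g K K gaut.
  exact: (automorphism_kernel x gaut kerK).
have ginj : injective g by apply: bij_inj; case: gaut.
have huP : h u' = u' \/ h u' = v'.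
  by apply/centre/(centre_isomorphism hiso)/centre; left.
have hvP : h v' = u' \/ h v' = v'.
  by apply/centre/(centre_isomorphism hiso)/centre; right.
have huv : h u' <> h v'.
  move/(congr1 val); rewrite !hE => /ginj; rewrite u'E v'E => uv.
  by move: adjuv; rewrite uv adj_irr.
have gu : g u = val (h u') by rewrite hE u'E.
have gv : g v = val (h v') by rewrite hE v'E.
rewrite gu gv -u'E -v'E.
by case: huP huv => ->; case: hvP => -> // _; [left|right].
Qed.

(** * Walks and parents in rooted trees *)

(** The inclusion of vertices records that whatever a walk avoids, its reversal avoids. *)
Lemma walk_rev (A : eqType) (e : rel A) (x : A) (p : seq A) :
  symmetric e -> path e x p ->
  exists q, [/\ path e (last x p) q, last (last x p) q = x &
                {subset last x p :: q <= x :: p}].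
Proof.
move=> esym xp; exists (rev (belast x p)); split.
- by rewrite rev_path (eq_path (e' := e)).
- by case: p {xp} => //= y p; rewrite rev_cons last_rcons.
- by move=> z; rewrite -rev_rcons -lastI mem_rev.
Qed.

Lemma connected_to_sym (G : graph) (x y : G) :
  connected_to x y -> connected_to y x.
Proof.
move=> [p xp <-]; have [q [yq qx _]] := walk_rev (@adj_sym G) xp.
by exists q.
Qed.

Lemma connected_to_trans (G : graph) (y x z : G) :
  connected_to x y -> connected_to y z -> connected_to x z.
Proof.
by move=> [p xp py] [q yq qz]; exists (p ++ q);
  rewrite ?cat_path ?last_cat py ?xp.
Qed.

(** Otherwise a simple path from [a] to [b], extracted from the walk, closes up through [x] to a
    cycle of length at least 3. *)
Lemma acyclic_detour (G : graph) (x a b : G) (p : seq G) :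
  acyclic G -> adj x a -> adj x b -> path (@adj G) a p -> last a p = b ->
  x \notin a :: p -> a = b.
Proof.
move=> acyG xa xb ap pb; move: xb; rewrite -pb => {b pb}.
case: (shortenP ap) => -[//|c q] aq uq qp xb xp; exfalso.
apply: (acyG [:: x, a, c & q]) => //; apply/andP; split.
  by rewrite /= xa; move: aq => /= /andP[-> cq];
    rewrite rcons_path cq adj_sym.
rewrite cons_uniq uq andbT; apply: contra xp; rewrite inE [_ \in a :: p]inE.
by case/orP=> [->//|/qp ->]; rewrite orbT.
Qed.

Definition rooted_tree (G : rooted_graph) : Prop := connected G /\ acyclic G.

(** The next vertex on the way to the root, singled out by a walk avoiding [x] instead of by
    comparing distances. *)
Definition is_parent (G : rooted_graph) (x y : G) : Prop :=
  adj x y /\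
  exists p, [/\ path (@adj G) y p, last y p = root G & x \notin y :: p].

Lemma is_parent_nonroot (G : rooted_graph) (x y : G) :
  is_parent x y -> x <> root G.
Proof. by move=> [_ [p [_ pr xp]]] xr; rewrite xr -pr mem_last in xp. Qed.

(** Two parents are joined through the root by a walk avoiding [x], so [acyclic_detour] identifies
    them. *)
Lemma is_parent_unique (G : rooted_graph) (x y z : G) :
  acyclic G -> is_parent x y -> is_parent x z -> y = z.
Proof.
move=> acyG [xy [p [yp pr xNp]]] [xz [q [zq qr xNq]]].
have [q' [rq' q'z q'q]] := walk_rev (@adj_sym G) zq.
apply: (acyclic_detour acyG xy xz (p := p ++ q')).
- by rewrite cat_path yp pr -qr.
- by rewrite last_cat pr -qr.
- rewrite -cat_cons mem_cat negb_or xNp; apply: contra xNq => xq'.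
  by apply: q'q; rewrite inE xq' orbT.
Qed.

Lemma is_parent_exists (G : rooted_graph) (x : G) :
  connected G -> x <> root G -> exists y, is_parent x y.
Proof.
move=> conG xr; have [p xp] := conG x (root G).
case: (shortenP xp) => -[|y q] //= /andP[xy yq] /andP[xq _] _ qr.
by exists y; split=> //; exists q.
Qed.

(** Take a simple path from [x] to the root. If it misses [y], it shows that [x] is the parent of
    [y]; if it meets [y], its tail from [y] avoids [x]. *)
Lemma adj_is_parent (G : rooted_graph) (x y : G) :
  connected G -> adj x y -> is_parent x y \/ is_parent y x.
Proof.
move=> conG xy; have [p xp] := conG x (root G).
case: (shortenP xp) => q xq uq _ qr.
have [yq|yNq] := boolP (y \in x :: q); last first.
  by right; split; [rewrite adj_sym|exists q].
left; split=> //; move: yq; rewrite inE => /orP[/eqP yx|yq].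
  by rewrite yx adj_irr in xy.
case/splitPr: yq => q1 q2 in xq uq qr *; exists q2; split.
- by move: xq; rewrite cat_path /= => /and3P[].
- by move: qr; rewrite last_cat.
- by move: uq; rewrite cons_uniq mem_cat negb_or => /andP[/andP[]].
Qed.

(** The walk from [y] to the root that avoids [x] begins, once made simple, with a parent of [y]; by
    uniqueness this would be [x]. *)
Lemma is_parent_asym (G : rooted_graph) (x y : G) :
  acyclic G -> is_parent x y -> ~ is_parent y x.
Proof.
move=> acyG [xy [p [yp pr xp]]] yx.
have y_nonroot := is_parent_nonroot yx.
case: (shortenP yp) pr => -[|z q] //= /andP[yz zq] /andP[yNq _] qp qr.
have /(is_parent_unique acyG yx) xz : is_parent y z by split=> //; exists q.
by move: xp; rewrite inE xz (qp z) ?orbT // inE eqxx.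
Qed.

Lemma is_parent_isomorphism (G H : rooted_graph) (g : G -> H) (x y : G) :
  rooted_isomorphism g -> is_parent x y -> is_parent (g x) (g y).
Proof.
move=> [gbij gadj groot] [xy [p [yp pr xp]]]; split; first by rewrite gadj.
exists (map g p); split.
- by rewrite (mono_path gadj).
- by rewrite last_map pr.
- by rewrite -map_cons (mem_map (bij_inj gbij)).
Qed.

(** * Vertex colourings read as edge colourings *)

Definition maps_edges (G H : graph) (g : G -> H) (c : G -> G -> nat)
  (d : H -> H -> nat) : Prop := forall x y, adj x y -> d (g x) (g y) = c x y.

(* In a rooted tree, the colour of a vertex other than the root is read as the
   colour of the edge to its parent. *)
Definition edge_of_vertex_colouring (G : rooted_graph) (c : G -> nat) (x y : G) :
  nat := if `[< is_parent x y >] then c x else c y.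

Lemma edge_of_vertex_colouringP (G : rooted_graph) (c : G -> nat) (k : nat) :
  rooted_tree G -> vertex_colouring k c ->
  edge_colouring k (edge_of_vertex_colouring c).
Proof.
move=> [conG acyG] ck x y xy; rewrite /edge_of_vertex_colouring; split.
  case: asboolP => [/(is_parent_asym acyG) nyx|nxy]; case: asboolP => //.
  by case: (adj_is_parent conG xy).
by case: asboolP.
Qed.

(** The root has no parent edge, so its colour [a] is free; every other vertex takes the colour of
    its unique parent edge. *)
Lemma vertex_of_edge_colouring (G : rooted_graph) (c : G -> G -> nat)
    (k a : nat) : rooted_tree G -> edge_colouring k c -> a < k ->
  exists d : G -> nat, [/\ vertex_colouring k d, d (root G) = a &
    forall x y, adj x y -> edge_of_vertex_colouring d x y = c x y].
Proof.
move=> [conG acyG] ck ak.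
have /choice[d dP] (x : G) : exists n, [/\ n < k, x = root G -> n = a &
    forall y, is_parent x y -> n = c x y].
  have [xr|xr] := pselect (x = root G).
    by exists a; split=> // y /is_parent_nonroot.
  have [y xpy] := is_parent_exists conG xr; exists (c x y); split=> //.
    by have [xy _] := xpy; case: (ck _ _ xy).
  by move=> z xpz; rewrite (is_parent_unique acyG xpy xpz).
exists d; split=> [x||x y xy]; [by case: (dP x)|by case: (dP (root G)) => _ ->|].
rewrite /edge_of_vertex_colouring; case: asboolP => xpy.
  by have [_ _ /(_ _ xpy)] := dP x.
have ypx : is_parent y x by case: (adj_is_parent conG xy).
by have [_ _ /(_ _ ypx) ->] := dP y; case: (ck _ _ xy).
Qed.

(** Isomorphisms carry parents to parents. The root is excluded because its colour is read on no
    edge. *)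
Lemma maps_edge_of_vertex_colouring (G H : rooted_graph) (g : G -> H)
    (c : G -> nat) (d : H -> nat) :
  rooted_tree G -> rooted_tree H -> rooted_isomorphism g ->
  (forall x, x <> root G -> d (g x) = c x) <->
  maps_edges g (edge_of_vertex_colouring c) (edge_of_vertex_colouring d).
Proof.
move=> [conG acyG] [conH acyH] giso; split=> [dc x y xy|dc x xr].
  rewrite /edge_of_vertex_colouring.
  case: (adj_is_parent conG xy) => par; have gpar := is_parent_isomorphism giso par.
    by rewrite !asboolT // dc //; apply: is_parent_nonroot par.
  rewrite !asboolF; first by apply: dc; apply: is_parent_nonroot par.
    exact: is_parent_asym par.
  exact: is_parent_asym gpar.
have [y xpy] := is_parent_exists conG xr; have [xy _] := xpy.
have := dc _ _ xy; rewrite /edge_of_vertex_colouring !asboolT //.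
exact: is_parent_isomorphism xpy.
Qed.

(** * Composition and inversion of rooted isomorphisms *)

Lemma rooted_isomorphism_id (G : rooted_graph) :
  rooted_isomorphism (@id G : G -> G).
Proof. by split=> //; exists id. Qed.

Lemma rooted_isomorphism_comp (G H I : rooted_graph) (f : G -> H) (g : H -> I) :
  rooted_isomorphism f -> rooted_isomorphism g -> rooted_isomorphism (g \o f).
Proof.
move=> [fbij fadj froot] [gbij gadj groot]; split; first exact: bij_comp.
- by move=> x y; rewrite gadj fadj.
- by rewrite /= froot.
Qed.

Lemma rooted_isomorphism_inv (G H : rooted_graph) (f : G -> H) :
  rooted_isomorphism f ->
  exists g, [/\ rooted_isomorphism g, cancel f g & cancel g f].
Proof.
move=> [[g fg gf] fadj froot]; exists g; split=> //; split.
- by exists f.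
- by move=> x y; rewrite -fadj !gf.
- by rewrite -froot fg.
Qed.

Lemma maps_edges_comp (G H I : graph) (f : G -> H) (g : H -> I)
    (c : G -> G -> nat) (d : H -> H -> nat) (e : I -> I -> nat) :
  {mono f : x y / adj x y} -> maps_edges f c d -> maps_edges g d e ->
  maps_edges (g \o f) c e.
Proof. by move=> fadj cd de x y xy; rewrite /= de ?fadj ?cd. Qed.

Lemma maps_edges_inv (G H : graph) (f : G -> H) (g : H -> G)
    (c : G -> G -> nat) (d : H -> H -> nat) :
  {mono g : x y / adj x y} -> cancel g f -> maps_edges f c d ->
  maps_edges g d c.
Proof. by move=> gadj gf cd x y xy; rewrite -cd ?gadj // !gf. Qed.

(** * A tree split into two rooted halves joined by an edge *)

(** With the embeddings as arguments, the two halves can be listed in either order; an exchange of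
    the halves is then a map from one splitting to the reversed one. *)
Record splits (T : graph) (G H : rooted_graph) (i : G -> T) (j : H -> T) :
    Prop := Splits {
  splits_treel : rooted_tree G;
  splits_treer : rooted_tree H;
  splits_injl : injective i;
  splits_injr : injective j;
  splits_adjl : {mono i : x y / adj x y};
  splits_adjr : {mono j : x y / adj x y};
  splits_disj : forall x y, i x <> j y;
  splits_cover : forall t, (exists x, t = i x) \/ (exists y, t = j y);
  splits_cross : forall x y, adj (i x) (j y) = (x == root G) && (y == root H) }.

Lemma splits_sym (T : graph) (G H : rooted_graph) (i : G -> T) (j : H -> T) :
  splits i j -> splits j i.
Proof.
case=> tl tr il ir al ar dis cov cro; split=> //.
- by move=> y x /esym/dis.
- by move=> t; apply/or_comm.
- by move=> y x; rewrite adj_sym cro andbC.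
Qed.

Lemma splits_fun (T : graph) (G H : rooted_graph) (i : G -> T) (j : H -> T)
    (A : Type) (f : G -> A) (g : H -> A) : splits i j ->
  exists h : T -> A, (forall x, h (i x) = f x) /\ (forall y, h (j y) = g y).
Proof.
move=> spl.
have /choice[h hP] (t : T) : exists a, (forall x, t = i x -> a = f x) /\
    (forall y, t = j y -> a = g y).
  case: (splits_cover spl t) => -[x ->].
    by exists (f x); split=> y; [move/(splits_injl spl) ->|move/(splits_disj spl)].
  exists (g x); split=> y; last by move/(splits_injr spl) ->.
  by move/esym/(splits_disj spl).
by exists h; split=> x; [apply: (hP (i x)).1|apply: (hP (j x)).2].
Qed.

(** The only edge between the halves joins the roots, which [f] and [g] respect. Equal splittings
    give an automorphism fixing the ends of that edge, reversed ones an automorphism exchanging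
    them. *)
Lemma glue_isomorphisms (T : graph) (G H G' H' : rooted_graph) (i : G -> T)
    (j : H -> T) (i' : G' -> T) (j' : H' -> T) (f : G -> G') (g : H -> H') :
  splits i j -> splits i' j' -> rooted_isomorphism f -> rooted_isomorphism g ->
  exists h : T -> T, [/\ automorphism h, forall x, h (i x) = i' (f x) &
    forall y, h (j y) = j' (g y)].
Proof.
move=> spl spl' fiso giso.
have [h [hi hj]] := splits_fun (i' \o f) (j' \o g) spl.
have [f' [_ ff' f'f]] := rooted_isomorphism_inv fiso.
have [g' [_ gg' g'g]] := rooted_isomorphism_inv giso.
have [h' [hi' hj']] := splits_fun (i \o f') (j \o g') spl'.
have [[fbij fadj froot] [gbij gadj groot]] := (fiso, giso).
have cross x y : adj (i' (f x)) (j' (g y)) = adj (i x) (j y).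
  rewrite (splits_cross spl) (splits_cross spl') -froot -groot.
  by rewrite (bij_eq fbij) (bij_eq gbij).
exists h; split=> //; split.
  exists h' => t.
    by case: (splits_cover spl t) => -[x ->]; rewrite ?hi ?hj /= ?hi' ?hj' /= ?ff' ?gg'.
  by case: (splits_cover spl' t) => -[x ->]; rewrite ?hi' ?hj' /= ?hi ?hj /= ?f'f ?g'g.
move=> s t; case: (splits_cover spl s) => -[x ->];
  case: (splits_cover spl t) => -[y ->]; rewrite ?hi ?hj /=.
- by rewrite (splits_adjl spl) (splits_adjl spl').
- exact: cross.
- by rewrite adj_sym cross adj_sym.
- by rewrite (splits_adjr spl) (splits_adjr spl').
Qed.

(** Follow walks of [G] from its root: their images could leave the half [G'] only at
    [j' (root H')], which is already the image of [j (root H)]. *)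
Lemma restrict_automorphism (T : graph) (G H G' H' : rooted_graph) (i : G -> T)
    (j : H -> T) (i' : G' -> T) (j' : H' -> T) (g : T -> T) :
  splits i j -> splits i' j' -> automorphism g ->
  g (i (root G)) = i' (root G') -> g (j (root H)) = j' (root H') ->
  exists h : G -> G', rooted_isomorphism h /\ forall x, g (i x) = i' (h x).
Proof.
have restrict (G1 H1 G2 H2 : rooted_graph) (i1 : G1 -> T) (j1 : H1 -> T)
    (i2 : G2 -> T) (j2 : H2 -> T) (f : T -> T) :
    splits i1 j1 -> splits i2 j2 -> automorphism f ->
    f (i1 (root G1)) = i2 (root G2) -> f (j1 (root H1)) = j2 (root H2) ->
    exists h : G1 -> G2, forall x, f (i1 x) = i2 (h x).
  move=> spl spl' [fbij fadj] fi fj.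
  suff /choice[h hE] (x : G1) : exists y, f (i1 x) = i2 y by exists h.
  have [conG _] := splits_treel spl.
  have [q rq <-] := conG (root _) x.
  elim/last_ind: q rq => [_|q y IH]; first by exists (root _).
  rewrite rcons_path last_rcons => /andP[/IH[z fz] zy].
  have [//|[w fy]] := splits_cover spl' (f (i1 y)).
  have : adj (i2 z) (j2 w) by rewrite -fz -fy fadj (splits_adjl spl).
  rewrite (splits_cross spl') => /andP[_ /eqP wr].
  by move: fy; rewrite wr -fj => /(bij_inj fbij)/(splits_disj spl).
move=> spl spl' gaut gi gj.
have [h hE] := restrict _ _ _ _ _ _ _ _ _ spl spl' gaut gi gj.
have [g' [gaut' gg' g'g]] := graph_isomorphism_inv gaut.
(* The inverse automorphism restricts in the same way and yields the inverse of [h]. *)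
have [||h' hE'] := restrict _ _ _ _ _ _ _ _ g' spl' spl gaut'.
- by rewrite -gi gg'.
- by rewrite -gj gg'.
exists h; split=> //; split.
- exists h' => x; first by apply: (splits_injl spl); rewrite -hE' -hE gg'.
  by apply: (splits_injl spl'); rewrite -hE -hE' g'g.
- move=> x y; rewrite -(splits_adjl spl') -!hE -(splits_adjl spl).
  by case: gaut.
- by apply: (splits_injl spl'); rewrite -hE.
Qed.

(** * Isomorphic colourings and the use of a fresh colour *)

Definition colour_isomorphic (G H : rooted_graph) (c : G -> G -> nat)
  (d : H -> H -> nat) : Prop :=
  exists2 f : G -> H, rooted_isomorphism f & maps_edges f c d.

(** Colourings that agree on edges may differ in their junk values, so they cannot simply be
    rewritten into each other. *)
Lemma rooted_edge_distinguishing_ext (G : rooted_graph) (c d : G -> G -> nat) :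
  (forall x y, adj x y -> c x y = d x y) ->
  rooted_edge_distinguishing c -> rooted_edge_distinguishing d.
Proof.
move=> cd dist g giso gd; apply: dist => // x y xy.
by rewrite !cd ?gd //; have [_ -> _] := giso.
Qed.

Lemma colour_isomorphic_ext (G H : rooted_graph) (c c' : G -> G -> nat)
    (d d' : H -> H -> nat) : (forall x y, adj x y -> c x y = c' x y) ->
  (forall x y, adj x y -> d x y = d' x y) ->
  colour_isomorphic c d -> colour_isomorphic c' d'.
Proof.
move=> cc' dd' [f fiso fc]; exists f => // x y xy.
by rewrite -cc' // -dd' ?fc //; have [_ -> _] := fiso.
Qed.

Lemma edge_colouringW (G : graph) (k l : nat) (c : G -> G -> nat) :
  k <= l -> edge_colouring k c -> edge_colouring l c.
Proof.
by move=> kl ck x y /ck[cs cl]; split=> //; apply: leq_trans kl.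
Qed.

(* The new colour [k] is given to a single edge, which every automorphism
   preserving the new colouring therefore fixes. *)
Lemma recolour_edge (G : rooted_graph) (c : G -> G -> nat) (k : nat) (w z : G) :
  adj w z -> edge_colouring k c -> rooted_edge_distinguishing c ->
  exists c', [/\ edge_colouring k.+1 c', rooted_edge_distinguishing c' &
    c' w z = k].
Proof.
move=> wz ck dist.
pose E x y := (x == w) && (y == z) || (x == z) && (y == w).
have Esym x y : E x y = E y x by rewrite /E orbC ![(x == _) && _]andbC.
have EP x y : E x y -> c x y = c w z.
  by case/orP=> /andP[/eqP-> /eqP->] //; have [] := ck _ _ wz.
exists (fun x y => if E x y then k else c x y); split.
- move=> x y xy; rewrite Esym; case: ifP => // _.
  by have [-> /ltnW] := ck _ _ xy.
- move=> g giso gc; apply: dist => // x y xy.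
  have gxy : adj (g x) (g y) by have [_ -> _] := giso.
  have := gc x y xy; have [_ lk] := ck _ _ gxy; have [_ lk'] := ck _ _ xy.
  case: ifP => [/EP->|_]; case: ifP => [/EP->|_] // ek.
    by rewrite -ek ltnn in lk'.
  by rewrite ek ltnn in lk.
- by rewrite /E !eqxx.
Qed.

(** * Distinguishing colourings of the tree in terms of its halves *)

Section TwoHalves.
Variables (T : graph) (G H : rooted_graph) (i : G -> T) (j : H -> T).
Hypothesis spl : splits i j.
Let u := i (root G).
Let v := j (root H).
Hypothesis fix_or_swap : forall g : T -> T, automorphism g ->
  g u = u /\ g v = v \/ g u = v /\ g v = u.

Definition halves_distinguishing (k : nat) (c : G -> G -> nat)
    (d : H -> H -> nat) : Prop :=
  [/\ edge_colouring k c, rooted_edge_distinguishing c, edge_colouring k d &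
      rooted_edge_distinguishing d].

Let treeG : rooted_tree G := splits_treel spl.
Let treeH : rooted_tree H := splits_treer spl.

(** The first two clauses deal with automorphisms fixing [u] and [v], the third with those
    exchanging them; only the latter can be excluded by the colours of the roots. *)
Lemma vertex_distinguishing_halves (c : T -> nat) :
  vertex_distinguishing c <->
  [/\ rooted_edge_distinguishing (edge_of_vertex_colouring (c \o i)),
      rooted_edge_distinguishing (edge_of_vertex_colouring (c \o j)) &
      c u = c v -> ~ colour_isomorphic (edge_of_vertex_colouring (c \o i))
                                       (edge_of_vertex_colouring (c \o j))].
Proof.
split=> [dist|[distG distH noniso] g gaut gc].
  split.
  - move=> g giso /(maps_edge_of_vertex_colouring _ _ treeG treeG giso) gc x.
    (* [g] is extended by the identity on the other half. *)
    have [h [haut hi hj]] :=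
      glue_isomorphisms spl spl giso (rooted_isomorphism_id H).
    apply: (splits_injl spl); rewrite -hi; apply: dist haut _ _ => t.
    case: (splits_cover spl t) => -[y ->]; rewrite ?hj // hi.
    have [yr|/gc//] := pselect (y = root G).
    by rewrite yr; have [_ _ ->] := giso.
  - move=> g giso /(maps_edge_of_vertex_colouring _ _ treeH treeH giso) gc x.
    have [h [haut hi hj]] :=
      glue_isomorphisms spl spl (rooted_isomorphism_id G) giso.
    apply: (splits_injr spl); rewrite -hj; apply: dist haut _ _ => t.
    case: (splits_cover spl t) => -[y ->]; rewrite ?hi // hj.
    have [yr|/gc//] := pselect (y = root H).
    by rewrite yr; have [_ _ ->] := giso.
  - move=> cuv [f fiso /(maps_edge_of_vertex_colouring _ _ treeG treeH fiso) fc].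
    have [f' [fiso' ff' f'f]] := rooted_isomorphism_inv fiso.
    (* [f] on one half and its inverse on the other form an exchange that preserves [c]. *)
    have [h [haut hi hj]] := glue_isomorphisms spl (splits_sym spl) fiso fiso'.
    have fc' x : c (j (f x)) = c (i x).
      have [->|/fc//] := pselect (x = root G).
      by have [_ _ ->] := fiso.
    apply: (splits_disj spl (x := root G) (y := root H)).
    have [_ _ <-] := fiso; rewrite -hi; apply/esym/(dist h) => // t.
    case: (splits_cover spl t) => -[y ->]; first by rewrite hi fc'.
    by rewrite hj -fc' f'f.
case: (fix_or_swap gaut) => -[gu gv].
  have [f [fiso fE]] := restrict_automorphism spl spl gaut gu gv.
  have [f' [fiso' fE']] := restrict_automorphism (splits_sym spl)
    (splits_sym spl) gaut gv gu.
  have fid : f =1 id.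
    apply: distG => //.
    apply/(maps_edge_of_vertex_colouring _ _ treeG treeG fiso) => x _.
    by rewrite /= -fE gc.
  have fid' : f' =1 id.
    apply: distH => //.
    apply/(maps_edge_of_vertex_colouring _ _ treeH treeH fiso') => x _.
    by rewrite /= -fE' gc.
  by move=> t; case: (splits_cover spl t) => -[x ->]; rewrite ?fE ?fE' ?fid ?fid'.
have [f [fiso fE]] := restrict_automorphism spl (splits_sym spl) gaut gu gv.
case: noniso; first by rewrite -gu gc.
exists f => //; apply/(maps_edge_of_vertex_colouring _ _ treeG treeH fiso) => x _.
by rewrite /= -fE gc.
Qed.

(** Every automorphism maps the central edge to itself, possibly reversed, so its colour never
    matters and the third clause is unconditional. *)
Lemma edge_distinguishing_halves (k : nat) (c : T -> T -> nat) :
  edge_colouring k c ->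
  edge_distinguishing c <->
  [/\ rooted_edge_distinguishing (fun x y => c (i x) (i y)),
      rooted_edge_distinguishing (fun x y => c (j x) (j y)) &
      ~ colour_isomorphic (fun x y => c (i x) (i y)) (fun x y => c (j x) (j y))].
Proof.
move=> ck.
(* Gluing with colours, applied below to [g] with the identity and to [f] with its inverse; the last
   premise concerns the image of the central edge. *)
have glued (G' H' : rooted_graph) (i' : G' -> T) (j' : H' -> T) f g :
    splits i' j' -> rooted_isomorphism f -> rooted_isomorphism g ->
    maps_edges f (fun x y => c (i x) (i y)) (fun x y => c (i' x) (i' y)) ->
    maps_edges g (fun x y => c (j x) (j y)) (fun x y => c (j' x) (j' y)) ->
    c (i' (root G')) (j' (root H')) = c u v ->
    exists h : T -> T, [/\ automorphism h, maps_edge_colouring h c c,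
      forall x, h (i x) = i' (f x) & forall y, h (j y) = j' (g y)].
  move=> spl' fiso giso fc gc cuv.
  have [h [haut hi hj]] := glue_isomorphisms spl spl' fiso giso.
  have cross x y : adj (i x) (j y) -> c (i' (f x)) (j' (g y)) = c (i x) (j y).
    rewrite (splits_cross spl) => /andP[/eqP -> /eqP ->].
    by have [[_ _ ->] [_ _ ->]] := (fiso, giso).
  exists h; split=> // s t; case: (splits_cover spl s) => -[x ->];
    case: (splits_cover spl t) => -[y ->]; rewrite ?hi ?hj /=.
  - by rewrite (splits_adjl spl); apply: fc.
  - exact: cross.
  (* The central edge read backwards: symmetry of [c] on it and on its image reduces this to
     [cross]. *)
  - move=> yx; have [-> _] := ck _ _ yx.
    rewrite adj_sym in yx; rewrite -cross //.
    have [_ hadj] := haut.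
    by apply: (ck _ _ _).1; rewrite -hi -hj hadj adj_sym.
  - by rewrite (splits_adjr spl); apply: gc.
split=> [dist|[distG distH noniso] g gaut gc].
  split.
  - move=> g giso gc x.
    have [h [haut hc hi hj]] :=
      glued _ _ i j g id spl giso (rooted_isomorphism_id H) gc
        (fun _ _ _ => erefl) erefl.
    by apply: (splits_injl spl); rewrite -hi; apply: dist.
  - move=> g giso gc x.
    have [h [haut hc hi hj]] :=
      glued _ _ i j id g spl (rooted_isomorphism_id G) giso
        (fun _ _ _ => erefl) gc erefl.
    by apply: (splits_injr spl); rewrite -hj; apply: dist.
  - move=> [f fiso fc].
    have [f' [fiso' ff' f'f]] := rooted_isomorphism_inv fiso.
    have [||h [haut hc hi hj]] := glued _ _ j i f f' (splits_sym spl) fiso fiso' fc.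
    + by have [_ f'adj _] := fiso'; apply: maps_edges_inv f'f fc.
    + by apply: (ck v u _).1; rewrite adj_sym (splits_cross spl) !eqxx.
    apply: (splits_disj spl (x := root G) (y := root H)).
    by have [_ _ <-] := fiso; rewrite -hi; apply/esym/(dist h).
case: (fix_or_swap gaut) => -[gu gv].
  have [f [fiso fE]] := restrict_automorphism spl spl gaut gu gv.
  have [f' [fiso' fE']] := restrict_automorphism (splits_sym spl)
    (splits_sym spl) gaut gv gu.
  have fid : f =1 id.
    by apply: distG => // x y xy; rewrite -!fE gc ?(splits_adjl spl).
  have fid' : f' =1 id.
    by apply: distH => // x y xy; rewrite -!fE' gc ?(splits_adjr spl).
  by move=> t; case: (splits_cover spl t) => -[x ->]; rewrite ?fE ?fE' ?fid ?fid'.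
have [f [fiso fE]] := restrict_automorphism spl (splits_sym spl) gaut gu gv.
case: noniso; exists f => // x y xy.
by rewrite -!fE gc ?(splits_adjl spl).
Qed.

Lemma halves_of_vertex_colouring (k : nat) (c : T -> nat) :
  vertex_colouring k c -> vertex_distinguishing c ->
  halves_distinguishing k (edge_of_vertex_colouring (c \o i))
                          (edge_of_vertex_colouring (c \o j)).
Proof.
move=> ck /vertex_distinguishing_halves[distG distH _].
by split=> //; apply: edge_of_vertex_colouringP => // x; apply: ck.
Qed.

(** Leaving the root colours [a] and [b] open covers equal colours, with non-isomorphic halves, and
    distinct colours, with arbitrary ones. *)
Lemma vertex_colouring_of_halves (k a b : nat) (c : G -> G -> nat)
    (d : H -> H -> nat) : a < k -> b < k -> halves_distinguishing k c d ->
  (a = b -> ~ colour_isomorphic c d) ->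
  exists e : T -> nat,
    [/\ vertex_colouring k e, vertex_distinguishing e, e u = a & e v = b].
Proof.
move=> ak bk [ck distc dk distd] noniso.
have [c' [ck' c'r c'E]] := vertex_of_edge_colouring treeG ck ak.
have [d' [dk' d'r d'E]] := vertex_of_edge_colouring treeH dk bk.
have [e [ei ej]] := splits_fun c' d' spl.
have eiE : e \o i = c' by apply/funext.
have ejE : e \o j = d' by apply/funext.
exists e; split.
- by move=> t; case: (splits_cover spl t) => -[x ->]; rewrite ?ei ?ej.
- apply/vertex_distinguishing_halves; rewrite eiE ejE; split.
  + by apply: rooted_edge_distinguishing_ext distc => x y /c'E.
  + by apply: rooted_edge_distinguishing_ext distd => x y /d'E.
  + by rewrite /u /v ei ej c'r d'r => /noniso ab /(colour_isomorphic_ext c'E d'E).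
- by rewrite /u ei.
- by rewrite /v ej.
Qed.

(** The common meaning, for positive [k], of having a distinguishing [k]-edge colouring and of
    having a distinguishing [k]-vertex colouring equal on [u] and [v]. *)
Definition nonisomorphic_halves (k : nat) : Prop :=
  exists c d, halves_distinguishing k c d /\ ~ colour_isomorphic c d.

Lemma nonisomorphic_halvesW (k l : nat) :
  k <= l -> nonisomorphic_halves k -> nonisomorphic_halves l.
Proof.
move=> kl [c [d [[ck distc dk distd] noniso]]]; exists c, d; split=> //.
by split=> //; apply: edge_colouringW kl _.
Qed.

Lemma edge_colouring_halves (k : nat) : 0 < k ->
  (exists c : T -> T -> nat, edge_colouring k c /\ edge_distinguishing c) <->
  nonisomorphic_halves k.
Proof.
move=> k_gt0; split=> [[c [ck /(edge_distinguishing_halves ck)[dG dH noniso]]]|].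
  exists (fun x y => c (i x) (i y)), (fun x y => c (j x) (j y)); split=> //.
  split=> // x y xy; apply: ck.
    by rewrite (splits_adjl spl).
  by rewrite (splits_adjr spl).
move=> [c [d [[ck distc dk distd] noniso]]].
have [f [fi fj]] := splits_fun (@inl G H) (@inr G H) spl.
(* Pairs across the halves, among them the central edge, get colour 0, which is below [k] as [k] is
   positive. *)
pose e s t := match f s, f t with
  | inl x, inl y => c x y | inr x, inr y => d x y | _, _ => 0 end.
have ek : edge_colouring k e.
  move=> s t; rewrite /e; case: (splits_cover spl s) => -[x ->];
    case: (splits_cover spl t) => -[y ->]; rewrite ?fi ?fj //.
    by rewrite (splits_adjl spl) => /ck.
  by rewrite (splits_adjr spl) => /dk.
exists e; split=> //; apply/(edge_distinguishing_halves ek).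
have eiE : (fun x y => e (i x) (i y)) = c.
  by apply/funext => x; apply/funext => y; rewrite /e !fi.
have ejE : (fun x y => e (j x) (j y)) = d.
  by apply/funext => x; apply/funext => y; rewrite /e !fj.
by rewrite eiE ejE.
Qed.

Lemma vertex_colouring_halves (k : nat) : 0 < k ->
  (exists c : T -> nat,
     vertex_colouring k c /\ vertex_distinguishing c /\ c u = c v) <->
  nonisomorphic_halves k.
Proof.
move=> k_gt0; split=> [[c [ck [dist cuv]]]|[c [d [cd noniso]]]].
  exists (edge_of_vertex_colouring (c \o i)), (edge_of_vertex_colouring (c \o j)).
  split; first exact: halves_of_vertex_colouring.
  by have /vertex_distinguishing_halves[_ _] := dist; apply.
have [//|e [ek dist eu ev]] :=
  vertex_colouring_of_halves k_gt0 k_gt0 cd.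
by exists e; rewrite eu ev.
Qed.

(** From left to right, a fixed [d] on [H] serves as reference: all colourings of [G] are isomorphic
    to it, hence to each other. From right to left, an isomorphism of the halves moves colourings
    between [G] and [H]. *)
Lemma halves_unique (k : nat) :
  (exists c d, halves_distinguishing k c d) /\ ~ nonisomorphic_halves k <->
  rooted_isomorphic G H /\ unique_rooted_edge_distinguishing G k.
Proof.
split=> [[[c [d [ck distc dk distd]]] unique]|].
  have iso (e : G -> G -> nat) : edge_colouring k e -> rooted_edge_distinguishing e ->
      colour_isomorphic e d.
    move=> ek diste; apply: contrapT => noniso.
    by apply: unique; exists e, d.
  have [f fiso fc] := iso c ck distc.
  split; first by exists f.
  split=> [|e e' ek diste ek' diste']; first by exists c.
  have [[g giso ge] [g' giso' ge']] := (iso e ek diste, iso e' ek' diste').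
  have [h [hiso g'h hg']] := rooted_isomorphism_inv giso'.
  exists (h \o g); split; first exact: rooted_isomorphism_comp giso hiso.
  apply: (maps_edges_comp (d := d)) => //; first by case: giso.
  by apply: maps_edges_inv hg' ge'; case: hiso.
move=> [[f fiso] [[c [ck distc]] unique]].
have [f' [fiso' ff' f'f]] := rooted_isomorphism_inv fiso.
have [_ fadj _] := fiso; have [_ fadj' _] := fiso'.
split.
  exists c, (fun x y => c (f' x) (f' y)); split=> //.
    by move=> x y xy; apply: ck; rewrite fadj'.
  move=> g giso gc y.
  (* Conjugating [g] by [f] gives an automorphism of [G] preserving [c]. *)
  have /(distc (f' \o g \o f)) -/(_ _ (f' y)): rooted_isomorphism (f' \o g \o f).
    apply: rooted_isomorphism_comp fiso _.
    exact: rooted_isomorphism_comp giso fiso'.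
  rewrite /= f'f => e; rewrite -[LHS]f'f e ?f'f // => x z xz.
  by rewrite /= gc ?fadj // !ff'.
move=> [c1 [d1 [[ck1 distc1 dk1 distd1] noniso]]].
(* Uniqueness is applied to [c1] and the pullback of [d1] along [f]. *)
have [] := unique c1 (fun x y => d1 (f x) (f y)) ck1 distc1.
- by move=> x y xy; apply: dk1; rewrite fadj.
- move=> g giso gd x.
  have /distd1 e : rooted_isomorphism (f \o g \o f').
    apply: rooted_isomorphism_comp fiso' _.
    exact: rooted_isomorphism_comp giso fiso.
  have /(_ (f x)) : f \o g \o f' =1 id.
    by apply: e => y z yz; rewrite /= gd ?fadj' // !f'f.
  by rewrite /= ff' => /(bij_inj (let: And3 b _ _ := fiso in b)).
- move=> g [giso gc]; apply: noniso; exists (f \o g).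
    exact: rooted_isomorphism_comp fiso.
  by move=> x y xy; rewrite /= gc.
Qed.

End TwoHalves.

(** * The components left by deleting the central edge *)

(** A walk starting in the component stays there and so lifts to it; a cycle of the component is a
    cycle of [G]. *)
Lemma component_tree (G : graph) (x : G) : acyclic G -> rooted_tree (component x).
Proof.
move=> acyG; split=> [y z|[//|y s] ys /andP[cyc uniqs]].
  have lift (q : seq G) (a : component x) : path (@adj G) (val a) q ->
      last (val a) q = val z -> connected_to a z.
    elim: q a => [|b q IH] a /=; first by move=> _ /val_inj ->; exists [::].
    move=> /andP[ab bq] qz.
    have xb : b \in component_set x.
      apply/mem_set; apply: connected_to_trans (set_mem (valP a)) _.
      by exists [:: b]; rewrite //= ab.
    apply: (connected_to_trans (y := exist _ b xb : component x)).
      by exists [:: exist _ b xb : component x] => //=; rewrite andbT.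
    exact: IH.
  have yx := connected_to_sym (set_mem (valP y)).
  by have [q yq /(lift _ _ yq)] := connected_to_trans yx (set_mem (valP z)).
apply: (acyG (map val (y :: s))); first by rewrite size_map.
apply/andP; split; last by rewrite map_inj_uniq //; apply: val_inj.
by rewrite /= -map_rcons (mono_path (e := @adj (component x))).
Qed.

Section CentralEdge.
Variables (T : graph) (u v : T).
Hypotheses (treeT : is_tree T) (uv : adj u v).
Let D : graph := delete_edge u v.

Lemma adj_delete_edge (x y : T) : adj x y ->
  [\/ @adj D x y, x = u /\ y = v | x = v /\ y = u].
Proof.
move=> xy; have [/orP[]/andP[/eqP-> /eqP->]|nE] :=
  boolP ((x == u) && (y == v) || (x == v) && (y == u)).
- by constructor 2.
- by constructor 3.
- by constructor 1; rewrite /= xy.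
Qed.

(** A simple path from [u] to [v] without the edge [uv] would close up with it to a cycle. *)
Lemma delete_edge_disconnected : ~ @connected_to D u v.
Proof.
move=> [p up pv]; case: (shortenP up) pv => -[|a [|b q]] uq uniq_q _ /= qv.
- by move: uv; rewrite qv adj_irr.
- by move: uq; rewrite qv /= !eqxx andbF.
- have [_ acyT] := treeT; apply: (acyT [:: u, a, b & q]) => //.
  apply/andP; split=> //.
  have /(sub_path (e' := @adj T)) uq' : subrel (@adj D) (@adj T).
    by move=> x y /andP[].
  rewrite /cycle rcons_path; apply/andP; split; first exact: uq'.
  by rewrite /= qv adj_sym.
Qed.

Lemma delete_edge_splits :
  splits (fun x : @component D u => val x : T) (fun x : @component D v => val x : T).
Proof.
have [conT acyT] := treeT.
have acyD : acyclic D.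
  move=> s s2 /andP[cyc us]; apply: (acyT s) => //; apply/andP; split=> //.
  by apply: sub_cycle cyc => x y /andP[].
have conD (w : T) (x : @component D w) : @connected_to D w (val x).
  by apply: set_mem; case: x.
have disj (x : @component D u) (y : @component D v) : val x <> val y.
  move=> xy; apply: delete_edge_disconnected.
  apply: connected_to_trans (conD _ x) _; rewrite xy.
  exact: connected_to_sym (conD _ y).
(* The deleted edge has its ends in different components, so inside one component nothing was
   deleted. *)
have adjE (w x y : T) : @connected_to D w x -> @connected_to D w y ->
    @adj D x y = adj x y.
  move=> wx wy; apply/idP/idP => [/andP[]//|/adj_delete_edge[//||]] [xE yE];
    subst x y; exfalso; apply: delete_edge_disconnected;
    by apply: connected_to_trans; [apply: connected_to_sym|]; eassumption.
split.
- exact: component_tree.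
- exact: component_tree.
- exact: val_inj.
- exact: val_inj.
- by move=> x y; rewrite -(adjE u).
- by move=> x y; rewrite -(adjE v).
- exact: disj.
- move=> t; suff [ut|vt] : @connected_to D u t \/ @connected_to D v t.
  + by left; exists (exist _ t (mem_set ut)).
  + by right; exists (exist _ t (mem_set vt)).
  have [p up <-] := conT u t.
  (* Along a walk of [T] from [u], each step stays in its component or uses the deleted edge and
     ends at [u] or [v]. *)
  elim/last_ind: p up => [_|p a IH]; first by left; exists [::].
  rewrite rcons_path last_rcons => /andP[/IH{}IH /adj_delete_edge[]].
  + move=> pa; have {}pa : @connected_to D (last u p) a.
      by exists [:: a] => //; apply/andP.
    by case: IH => /connected_to_trans/(_ pa); [left|right].
  + by move=> [_ ->]; right; exists [::].
  + by move=> [_ ->]; left; exists [::].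
- move=> x y; apply/idP/andP => [/adj_delete_edge[xy|[xu yv]|[xv yu]]|].
  + exfalso; apply: delete_edge_disconnected.
    apply: connected_to_trans (conD _ x) _.
    apply: (connected_to_trans (y := val y)); last exact: connected_to_sym.
    by exists [:: val y] => //; apply/andP.
  + by split; apply/eqP/val_inj.
  + by exfalso; apply: delete_edge_disconnected; rewrite -xv.
  + by move=> [/eqP -> /eqP ->].
Qed.

End CentralEdge.

(** * Equivalence of the three conditions *)

Theorem theorem13 (T : graph) (u v : T) (huv : bicentred_at u v)
    (hK2 : exists w : T, w <> u /\ w <> v) (k : nat) (hk : 2 <= k) :
  let T1 : rooted_graph := @component (delete_edge u v) u in
  let T2 : rooted_graph := @component (delete_edge u v) v in
  let cond_i : Prop :=
    distinguishing_number_is T k /\ distinguishing_index_is T (k + 1) in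
  let cond_ii : Prop :=
    distinguishing_number_is T k /\
    ~ (exists c : T -> nat,
         vertex_colouring k c /\ vertex_distinguishing c /\ c u = c v) in
  let cond_iii : Prop :=
    rooted_isomorphic T1 T2 /\ unique_rooted_edge_distinguishing T1 k in
  (cond_i <-> cond_ii) /\ (cond_ii <-> cond_iii).
Proof.
move=> T1 T2 cond_i cond_ii cond_iii.
have [treeT _ uv _] := huv.
pose i (x : T1) : T := val x; pose j (x : T2) : T := val x.
have spl : splits i j := delete_edge_splits treeT uv.
have swap g : automorphism g -> g (i (root T1)) = i (root T1) /\
    g (j (root T2)) = j (root T2) \/ g (i (root T1)) = j (root T2) /\
    g (j (root T2)) = i (root T1) := @bicentred_fix_or_swap T u v g huv.
have k_gt0 : 0 < k by apply: ltnW.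
pose N := @nonisomorphic_halves T1 T2.
have VE := vertex_colouring_halves spl swap k_gt0.
have E l : 0 < l -> _ := @edge_colouring_halves _ _ _ _ _ spl swap l.
have unique := @halves_unique T1 T2 k.
(* The hub of the equivalences: (iii) by [halves_unique], and shown below to be (ii) and (i) as
   well. *)
pose M := (exists c d, @halves_distinguishing T1 T2 k c d) /\ ~ N k.
have recoloured l c d : @halves_distinguishing T1 T2 l c d -> N l.+1.
  move=> cd; have [[ck distc dk distd] ll1] := (cd, leqnSn l).
  have [[f fiso _]|noniso] := pselect (colour_isomorphic c d); last first.
    by apply: (nonisomorphic_halvesW ll1); exists c, d.
  (* The third vertex of [T] gives a non-root vertex of [T1], if necessary through [f'], hence an
     edge to recolour. In a single edge the exchange preserves every edge colouring, so D'(T) would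
     not exist. *)
  have [x xr] : exists x : T1, x <> root T1.
    have [w [wu wv]] := hK2; case: (splits_cover spl w) => -[x wx].
      by exists x => xr; apply: wu; rewrite wx xr.
    have [f' [[_ _ f'r] ff' f'f]] := rooted_isomorphism_inv fiso.
    exists (f' x); rewrite -f'r => /(can_inj f'f) xr.
    by apply: wv; rewrite wx xr.
  have [conT1 _] := splits_treel spl.
  have [y [xy _]] := is_parent_exists conT1 xr.
  (* Colours of [d] stay below [l], so no isomorphism can match the edge that [c'] colours with
     [l]. *)
  have [c' [ck' distc' c'xy]] := recolour_edge xy ck distc.
  exists c', d; split; first by split=> //; apply: edge_colouringW ll1 _.
  move=> [g [_ gadj _] gc']; have gxy : adj (g x) (g y) by rewrite gadj.
  by have [_] := dk _ _ gxy; rewrite gc' // c'xy ltnn.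
have M_number : M -> distinguishing_number_is T k.
  move=> Mk; have [[c [d cd]] nNk] := Mk; split.
    (* As [k] is at least 2, the ends of the central edge can get the colours 0 and 1, which rules
       out an exchange. *)
    by have [//|e [? ? _ _]] :=
      vertex_colouring_of_halves spl swap k_gt0 hk cd; exists e.
  move=> l [e [el dist]]; rewrite leqNgt; apply/negP => lk.
  apply: nNk; apply: nonisomorphic_halvesW lk _.
  exact: recoloured (halves_of_vertex_colouring spl swap el dist).
have ii_M : cond_ii <-> M.
  split=> [[[[c [ck dist]] _] nVE]|Mk].
    split; last by move/VE.
    by eexists; eexists; apply: (halves_of_vertex_colouring spl swap ck dist).
  by split; [apply: M_number|move/VE; case: Mk].
split; last exact: iff_trans ii_M unique.
split=> [[Dk [_ Emin]]|/ii_M Mk].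
  (* A colouring with [c u = c v] would give a distinguishing edge colouring with [k] colours,
     against D'(T) = k + 1. *)
  split=> // /VE/E-/(_ k_gt0)/Emin.
  by rewrite addn1 ltnn.
split; first exact: M_number.
rewrite addn1; have [[c [d cd]] nNk] := Mk; split.
  by apply/E => //; apply: recoloured cd.
move=> l El; rewrite ltnNge; apply/negP => lk; apply: nNk.
apply: (nonisomorphic_halvesW lk); apply/E => //.
(* [l] is positive because the central edge itself carries a colour below [l]. *)
by have [e [el _]] := El; have [_] := el _ _ uv; case: (l).
Qed.
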